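(* Let $k$ be a field and let $p,m\ge 1$, $n\ge 0$ be integers. The set $\{\chi(\alpha^{(a)}) : \alpha^{(a)}\in\mathcal{C}^{np}_{p,m}\}$ of row-consecutive $p\times p$-minors of the generic $p(n+1)\times(m+p)$-matrix $\mathcal{L}$ is a sagbi basis with respect to the degree reverse lexicographic term order $\prec$ on $k[X]$; that is, the initial algebra with respect to $\prec$ of the $k$-subalgebra of $k[X]$ generated by these minors is generated by their initial monomials.
   Context: $k[X]$ is the polynomial ring over $k$ in the variables $x_{i,j}^{(l)}$, $1\le i\le p$, $1\le j\le m+p$, $0\le l\le n$. The variables are totally ordered by lexicographic order on the triples $(l,i,j)$ (so $x_{1,2}^{(0)}<x_{1,2}^{(1)}<x_{1,5}^{(1)}<x_{2,3}^{(1)}<x_{1,3}^{(2)}$), and $\prec$ is the resulting degree reverse lexicographic term order (for two distinct monomials of the same degree, take the smallest variable whose exponents in them differ; the monomial with the smaller exponent of that variable is the larger monomial). $\mathcal{L}$ is the $p(n+1)\times(m+p)$-matrix whose $(i,j)$ entry is $x_{r,j}^{(l)}$, where $i=pl+r$ with $1\le r\le p$ and $0\le l\le n$. $\binom{[m+p]}{p}$ is the set of sequences $\alpha=(\alpha_1<\dots<\alpha_p)$ of integers in $\{1,\dots,m+p\}$, and $\mathcal{C}^{np}_{p,m}$ is the set of formal symbols $\alpha^{(a)}$ with $\alpha\in\binom{[m+p]}{p}$ and $0\le a\le np$. The $k$-algebra homomorphism $\chi:k[\mathcal{C}^{np}_{p,m}]\to k[X]$ sends $\alpha^{(a)}$ to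 the $p\times p$-minor of $\mathcal{L}$ with rows $a+1,a+2,\dots,a+p$ and columns $\alpha_1,\dots,\alpha_p$. For a subalgebra $R\subset k[X]$, its initial algebra is the $k$-span of $\{\mathrm{in}_\prec(f):0\ne f\in R\}$. *)

(* Defs.v *)
From mathcomp Require Import all_boot all_order all_algebra.
From mathcomp Require Export mpoly.

Set Implicit Arguments.
Unset Strict Implicit.
Unset Printing Implicit Defensive.

Import Order.TTheory GRing.Theory.
Local Open Scope ring_scope.

(* Polynomials in variables indexed by a finite type V are encoded as
   {mpoly k[#|{: V}|]}, the variable v : V being 'X_(enum_rank v). *)

Section MonomialOrder.

Variables (d : Order.disp_t) (V : finOrderType d).
Implicit Types m : 'X_{1..#|{: V}|}.

Definition mexp m (v : V) : nat := m (enum_rank v).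

(* Degree reverse lexicographic order, v < w meaning that the variable v is
   smaller than the variable w.  It differs from mpoly's order (_ <= _)%O on
   monomials, which compares degrees and then exponents lexicographically. *)
Definition drl_lt m1 m2 : bool :=
  (mdeg m1 < mdeg m2)%N ||
  (mdeg m1 == mdeg m2) &&
  [exists v : V, [forall w : V, (w < v)%O ==> (mexp m1 w == mexp m2 w)]
                   && (mexp m2 v < mexp m1 v)%N].

Definition drl_le m1 m2 : bool := (m1 == m2) || drl_lt m1 m2.

Lemma mexp_inj m1 m2 : mexp m1 =1 mexp m2 -> m1 = m2.
Proof. by move=> e; apply/mnmP => i; have := e (enum_val i); rewrite /mexp enum_valK. Qed.

Lemma drl_lt_irr : irreflexive drl_lt.
Proof.
move=> m; rewrite /drl_lt ltnn eqxx /=; apply/existsP => -[v].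
by rewrite ltnn andbF.
Qed.

Lemma drl_lt_trans : transitive drl_lt.
Proof.
move=> m2 m1 m3; rewrite /drl_lt.
case/orP=> [lt12|/andP[/eqP-> /existsP[v /andP[/forallP ev ltv]]]].
  case/orP=> [lt23|/andP[/eqP<- _]]; last by rewrite lt12.
  by rewrite (ltn_trans lt12 lt23).
case/orP=> [->//|/andP[-> /existsP[w /andP[/forallP ew ltw]]]].
apply/orP; right=> /=; apply/existsP; exists (Order.min v w).
apply/andP; split.
  apply/forallP => u; apply/implyP; rewrite lt_min => /andP[uv uw].
  by have /implyP/(_ uv)/eqP-> := ev u; have /implyP/(_ uw) := ew u.
case: (ltgtP v w) => [vw|wv|evw].
- by have /implyP/(_ vw)/eqP<- := ew v.
- by have /implyP/(_ wv)/eqP-> := ev w.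
- by move: ltw; rewrite -evw => /ltn_trans; apply.
Qed.

Lemma drl_lt_total m1 m2 : m1 != m2 -> drl_lt m1 m2 || drl_lt m2 m1.
Proof.
move=> ne12; rewrite /drl_lt; case: ltngtP => //= _.
have [v nev] : exists v, mexp m1 v != mexp m2 v.
  apply/existsP; rewrite -negb_forall; apply: contra ne12 => /forallP e.
  by apply/eqP/mexp_inj => v; apply/eqP.
have [w new minw] := @arg_minP _ _ _ v (fun v => mexp m1 v != mexp m2 v) id nev.
have small u : (u < w)%O -> mexp m1 u = mexp m2 u.
  by move=> uw; apply/eqP; apply: contraTT uw => /minw; rewrite -leNgt.
have smallb u : (u < w)%O ==> (mexp m1 u == mexp m2 u).
  by apply/implyP => /small->.
have smallb' u : (u < w)%O ==> (mexp m2 u == mexp m1 u).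
  by apply/implyP => /small->.
move: new; rewrite neq_ltn => /orP[lt_w|lt_w]; apply/orP; [right|left].
  by apply/existsP; exists w; rewrite lt_w andbT; apply/forallP.
by apply/existsP; exists w; rewrite lt_w andbT; apply/forallP.
Qed.

Lemma drl_le_total : total drl_le.
Proof.
move=> m1 m2; rewrite /drl_le (eq_sym m2).
by case: (altP (m1 =P m2)) => //= /drl_lt_total.
Qed.

Lemma drl_le_trans : transitive drl_le.
Proof.
move=> m2 m1 m3 /orP[/eqP->//|lt12] /orP[/eqP<-|lt23].
  by rewrite /drl_le lt12 orbT.
by rewrite /drl_le (drl_lt_trans lt12 lt23) orbT.
Qed.

(* The exponent of the initial monomial, 0%MM if f = 0. *)
Definition init_mnm (k : nzRingType) (f : {mpoly k[#|{: V}|]}) :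
  'X_{1..#|{: V}|} := last 0%MM (sort drl_le (msupp f)).

Definition init_mon (k : nzRingType) (f : {mpoly k[#|{: V}|]}) :
  {mpoly k[#|{: V}|]} := 'X_[init_mnm f].

Lemma init_mnmP (k : nzRingType) (f : {mpoly k[#|{: V}|]}) : f != 0 ->
  init_mnm f \in msupp f /\
  {in msupp f, forall m, m != init_mnm f -> drl_lt m (init_mnm f)}.
Proof.
rewrite -msupp_eq0 /init_mnm => nz_f.
have := sort_sorted drl_le_total (msupp f).
have mem_s := mem_sort drl_le (msupp f).
have: sort drl_le (msupp f) != [::] by rewrite -size_eq0 size_sort size_eq0.
case/lastP: (sort _ _) mem_s => [//|s m] mem_s _ s_sorted.
rewrite last_rcons -mem_s mem_rcons mem_head; split=> // m' m'_f ne_m.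
have: m' \in s by move: m'_f; rewrite -mem_s mem_rcons inE (negPf ne_m).
move: s_sorted; rewrite (sorted_pairwise drl_le_trans) pairwise_rcons.
by case/andP=> /allP le_m _ /le_m /orP[/eqP e|//]; rewrite e eqxx in ne_m.
Qed.

End MonomialOrder.

Inductive lin_span (k : fieldType) (A : lmodType k) (S : A -> Prop) : A -> Prop :=
| lin_span0 : lin_span S 0
| lin_spanD c f g : S f -> lin_span S g -> lin_span S (c *: f + g).

Inductive gen_subalg (k : fieldType) (A : algType k) (S : A -> Prop) : A -> Prop :=
| gen_subalg_in f : S f -> gen_subalg S f
| gen_subalg_cst c : gen_subalg S c%:A
| gen_subalgD f g : gen_subalg S f -> gen_subalg S g -> gen_subalg S (f + g)
| gen_subalgM f g : gen_subalg S f -> gen_subalg S g -> gen_subalg S (f * g).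

Section Sagbi.

Variables (k : fieldType) (d : Order.disp_t) (V : finOrderType d).
Implicit Types S R : {mpoly k[#|{: V}|]} -> Prop.

Definition init_set S : {mpoly k[#|{: V}|]} -> Prop :=
  fun g => exists f, [/\ S f, f != 0 & g = init_mon f].

Definition init_alg R : {mpoly k[#|{: V}|]} -> Prop := lin_span (init_set R).

(* S is a sagbi basis, for the order drl_lt, of the subalgebra it generates. *)
Definition sagbi_basis S : Prop :=
  forall g, init_alg (gen_subalg S) g <-> gen_subalg (init_set S) g.

End Sagbi.

Section ConsecutiveMinors.

(* Row, column and variable indices are 0-based: ((l, r), j) stands for
   x_{r+1,j+1}^{(l)}. *)

Variables (k : fieldType) (p m n : nat).

Definition var := ('I_n.+1 *l 'I_p *l 'I_(m + p))%type.

Definition xvar (l : 'I_n.+1) (r : 'I_p) (j : 'I_(m + p)) :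
  {mpoly k[#|{: var}|]} := 'X_(enum_rank ((l, r, j) : var)).

Lemma row_level_subproof (i : 'I_(p * n.+1)) : (i %/ p < n.+1)%N.
Proof. by case: p i => [[]//|q] i; rewrite ltn_divLR // [ltnRHS]mulnC. Qed.

Lemma row_offset_subproof (i : 'I_(p * n.+1)) : (i %% p < p)%N.
Proof. by case: p i => [[]//|q] i; rewrite ltn_mod. Qed.

Definition row_level (i : 'I_(p * n.+1)) : 'I_n.+1 := Ordinal (row_level_subproof i).

Definition row_offset (i : 'I_(p * n.+1)) : 'I_p := Ordinal (row_offset_subproof i).

Definition Lmx : 'M[{mpoly k[#|{: var}|]}]_(p * n.+1, m + p) :=
  \matrix_(i, j) xvar (row_level i) (row_offset i) j.

Definition colseq :=
  {alpha : p.-tuple 'I_(m + p) | sorted ltn [seq nat_of_ord j | j <- alpha]}.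

Definition qsymb := (colseq * 'I_(n * p).+1)%type.

Lemma qrow_subproof (a : 'I_(n * p).+1) (t : 'I_p) : (a + t < p * n.+1)%N.
Proof. by rewrite mulnS addnC -addSn leq_add // [leqRHS]mulnC -ltnS. Qed.

Definition qrow (a : 'I_(n * p).+1) (t : 'I_p) : 'I_(p * n.+1) :=
  Ordinal (qrow_subproof a t).

Definition qminor (s : qsymb) : {mpoly k[#|{: var}|]} :=
  \det (mxsub (qrow s.2) (tnth (val s.1)) Lmx).

Definition qvar (s : qsymb) : {mpoly k[#|{: qsymb}|]} := 'X_(enum_rank s).

Definition chi (P : {mpoly k[#|{: qsymb}|]}) : {mpoly k[#|{: var}|]} :=
  P \mPo [tuple qminor (enum_val c) | c < #|{: qsymb}|].

Lemma chi_qvar s : chi (qvar s) = qminor s.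
Proof. by rewrite /chi comp_mpolyXU -tnth_nth tnth_mktuple enum_rankK. Qed.

Definition consecutive_minors : {mpoly k[#|{: var}|]} -> Prop :=
  fun f => exists s : qsymb, f = chi (qvar s).

End ConsecutiveMinors.

(* Main.v *)
From HB Require Import structures.
Require Import Defs.
From mathcomp Require Import all_boot all_order all_algebra perm.
From mathcomp Require Import zify.

(** Number the rows of the matrix from 0 and call the [p] consecutive rows of a
minor its window; window [a] consists of the rows a, ..., a + p - 1.  Variables
grow along the rows, and then from row to row.

The initial monomial of a minor is its antidiagonal ([init_qminor]).  Two facts
describe which monomials are products of antidiagonals.

Necessity.  Let f be a nonzero polynomial in the minors and w its initial
monomial.  One may keep only the products of minors that have the row degrees of
w ([row_component]), and these row degrees determine how many minors of each
window occur ([rowcount_inj]).  Let i, i+1 be adjacent rows contained in the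
windows of q of these minors, and let c be a column.  The claim is that
  (entries of w in row i+1 left of c) + (entries of w in row i right of c) >= q,
where entries are counted with multiplicity.  Let S be the set of variables in
these positions.  Substitute
  x(i+1,j) -> x(i+1,j) + x(i,j)  for j < c,
  x(i,j)   -> x(i,j) + x(i+1,j)  for j > c,
  x(i,c), x(i+1,c) -> 1.
Modulo the ideal generated by S the two rows become equal, so each of the q
minors is mapped into that ideal, and the image of f has order at least q with
respect to S ([equalise_minor], [order_qprod]).  On the other hand w, with its
entries in column c dropped, survives in the image of f: it occurs with
coefficient 1 in the image of w ([equalise_coeff]), and a monomial with the row
degrees of w whose image also contains it arises from w by moving entries in a
way that can only make the monomial larger for the reverse lexicographic order
([moved_drl]), so it does not occur in f.  Hence w has degree at least q on S
([stair_wdeg_ge]).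

Sufficiency ([antidiag_decomposition]).  Sort the entries of w in each row by
column, and number the minors by increasing window.  The minors that meet row i
form an interval of numbers, as long as the list of entries of row i; give the
entries to these minors in order.  If an entry given to some minor in row i+1
were not strictly left of the one given to it in row i, then counting on both
sides of its column would contradict the inequality above.  So each minor
receives a strictly decreasing sequence of columns, i.e. an antidiagonal, and w
is the product of these. *)

Set Implicit Arguments.
Unset Strict Implicit.
Unset Printing Implicit Defensive.

Import Order.TTheory GRing.Theory.
Local Open Scope ring_scope.

(** * Monomials, initial monomials and the criterion for a sagbi basis *)

Section InitialMonomials.

Variables (d : Order.disp_t) (V : finOrderType d).
Implicit Types (m : 'X_{1..#|{: V}|}) (v w : V) (P : pred V).

Lemma mexpD m1 m2 v : mexp (m1 + m2)%MM v = (mexp m1 v + mexp m2 v)%N.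
Proof. by rewrite /mexp mnmDE. Qed.

Lemma mexp0 v : mexp (0%MM : 'X_{1..#|{: V}|}) v = 0%N.
Proof. by rewrite /mexp mnm0E. Qed.

Lemma mexp1 v w : mexp U_(enum_rank v)%MM w = (v == w) :> nat.
Proof. by rewrite /mexp mnm1E (inj_eq enum_rank_inj). Qed.

Lemma mexp_sum (I : Type) (r : seq I) (F : I -> 'X_{1..#|{: V}|}) v :
  mexp (\sum_(i <- r) F i)%MM v = (\sum_(i <- r) mexp (F i) v)%N.
Proof. by rewrite /mexp mnm_sumE. Qed.

Lemma mdeg_mexp m : mdeg m = (\sum_v mexp m v)%N.
Proof.
rewrite mdegE (reindex (@enum_rank V)) //=.
by apply: onW_bij; apply: enum_rank_bij.
Qed.

Lemma mnm_ind (P : 'X_{1..#|{: V}|} -> Prop) :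
  P 0%MM -> (forall m v, P m -> P (m + U_(enum_rank v))%MM) -> forall m, P m.
Proof.
move=> P0 PD m; elim: {m}(mdeg m) {-2}m (erefl (mdeg m)) => [|k IH] m dm.
  by move/eqP: dm; rewrite mdeg_eq0 => /eqP->.
have: m != 0%MM by rewrite -mdeg_eq0 dm.
case: (pickP (fun i => m i != 0%N)) => [i mi _|m0 /eqP[]]; last first.
  by apply/mnmP => i; rewrite mnm0E; apply/eqP/negbFE/m0.
have le1 : (U_(i) <= m)%MM.
  by apply/mnm_lepP => j; rewrite mnm1E; case: eqP => [<-|//]; rewrite lt0n.
rewrite -(submK le1) -(enum_valK i); apply: (PD _ (enum_val i)); apply: IH.
by move: dm; rewrite -{1}(submK le1) mdegD mdeg1 enum_valK addn1 => -[].
Qed.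

Definition wdeg P m : nat := \sum_(v | P v) mexp m v.

Lemma wdegD P m1 m2 : wdeg P (m1 + m2)%MM = (wdeg P m1 + wdeg P m2)%N.
Proof. by rewrite /wdeg -big_split; apply: eq_bigr => v _; rewrite mexpD. Qed.

Lemma wdeg0 P : wdeg P 0%MM = 0%N.
Proof. by rewrite /wdeg big1 // => v _; rewrite mexp0. Qed.

Lemma wdeg1 P v : wdeg P U_(enum_rank v)%MM = P v :> nat.
Proof.
rewrite /wdeg big_mkcond (bigD1 v) //= mexp1 eqxx big1 ?addn0 => [|w ne].
  by case: (P v).
by rewrite mexp1 eq_sym (negPf ne) if_same.
Qed.

Lemma wdeg_sum P (I : Type) (r : seq I) (F : I -> 'X_{1..#|{: V}|}) :
  wdeg P (\sum_(i <- r) F i)%MM = (\sum_(i <- r) wdeg P (F i))%N.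
Proof. by elim/big_rec2: _ => [|i y1 m _ <-]; rewrite ?wdeg0 ?wdegD. Qed.

Lemma drl_ltD2r m m1 m2 : drl_lt (m1 + m)%MM (m2 + m)%MM = drl_lt m1 m2.
Proof.
rewrite /drl_lt !mdegD ltn_add2r eqn_add2r; congr (_ || _ && _).
apply: eq_existsb => v; rewrite !mexpD ltn_add2r; congr (_ && _).
by apply: eq_forallb => w; rewrite !mexpD eqn_add2r.
Qed.

Lemma drl_lt_asym m1 m2 : drl_lt m1 m2 -> drl_lt m2 m1 -> False.
Proof. by move=> lt12 /(drl_lt_trans lt12); rewrite drl_lt_irr. Qed.

Lemma drl_le_ltD m1 m2 m3 m4 :
  drl_le m1 m2 -> drl_lt m3 m4 -> drl_lt (m1 + m3)%MM (m2 + m4)%MM.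
Proof.
move=> le12 lt34; have lt1 : drl_lt (m1 + m3)%MM (m1 + m4)%MM.
  by rewrite ![(m1 + _)%MM]addmC drl_ltD2r.
case/orP: le12 => [/eqP<-//|lt12]; apply: drl_lt_trans lt1 _.
by rewrite drl_ltD2r.
Qed.

Section Field.

Variable k : fieldType.
Implicit Types f g : {mpoly k[#|{: V}|]}.

Lemma init_mnm_unique f m : m \in msupp f ->
  {in msupp f, forall m', m' != m -> drl_lt m' m} -> init_mnm f = m.
Proof.
move=> m_f max_m; have nz_f : f != 0.
  by apply: contraTneq m_f => ->; rewrite msupp0.
have [i_f max_i] := init_mnmP nz_f; apply/eqP/negPn/negP => ne.
by apply: (drl_lt_asym (max_m _ i_f ne)); apply: max_i; rewrite // eq_sym.
Qed.

Lemma init_mnm_le f m : m \in msupp f -> drl_le m (init_mnm f).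
Proof.
move=> m_f; have nz_f : f != 0.
  by apply: contraTneq m_f => ->; rewrite msupp0.
have [_ max_i] := init_mnmP nz_f; rewrite /drl_le.
by case: eqVneq => //= ne; apply: max_i.
Qed.

(** The coefficient of [f * g] at the sum of the initial monomials comes from the
    initial terms only, as every other sum of monomials is smaller. *)
Lemma init_mnmM f g : f != 0 -> g != 0 ->
  init_mnm (f * g) = (init_mnm f + init_mnm g)%MM.
Proof.
move=> nz_f nz_g; have [i_f max_f] := init_mnmP nz_f.
have [i_g max_g] := init_mnmP nz_g; apply: init_mnm_unique; last first.
  move=> _ /msuppM_le /allpairsP[[m1 m2] /= [m1f m2g ->]] ne.
  have [e2|ne2] := eqVneq m2 (init_mnm g); last first.
    by apply: drl_le_ltD; rewrite ?init_mnm_le ?max_g.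
  rewrite e2 drl_ltD2r max_f //; apply: contraNneq ne => e1.
  by rewrite e1 e2.
set m := (_ + _)%MM; have -> : (m \in msupp (f * g)) =
    (\sum_(m1 <- msupp f) f@_m1 * ('X_[m1] * g)@_m != 0).
  rewrite mcoeff_msupp {1}[f]mpolyE mulr_suml raddf_sum /=; congr (_ != _).
  by apply: eq_bigr => m1 _; rewrite -scalerAl mcoeffZ.
rewrite (bigD1_seq (init_mnm f)) ?msupp_uniq //= big1_seq => [|m1]; last first.
  case/andP=> ne1 m1f; have [->|] := eqVneq ('X_[m1] * g)@_m 0.
    by rewrite mulr0.
  rewrite -mcoeff_msupp => /msuppM_le /allpairsP[[m1' m2] /=].
  rewrite msuppX inE => -[/eqP-> m2g e].
  have: drl_lt (m1 + m2)%MM m.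
    rewrite /m addmC [X in drl_lt _ X]addmC.
    by apply: drl_le_ltD; rewrite ?init_mnm_le ?max_f.
  by rewrite -e drl_lt_irr.
by rewrite addr0 -commr_mpolyX mcoeffMX mulf_neq0 -?mcoeff_msupp.
Qed.

Lemma init_monM f g : f != 0 -> g != 0 -> init_mon (f * g) = init_mon f * init_mon g.
Proof. by move=> nz_f nz_g; rewrite /init_mon init_mnmM // mpolyXD. Qed.

Lemma init_mon1 : init_mon (1 : {mpoly k[#|{: V}|]}) = 1.
Proof.
rewrite /init_mon (_ : init_mnm _ = 0%MM) ?mpolyX0 //.
by apply: init_mnm_unique; rewrite msupp1 ?mem_head // => m; rewrite inE => /eqP-> /eqP.
Qed.

End Field.
End InitialMonomials.

Lemma mpolyX_sum (R : nzRingType) (l : nat) (I : Type) (r : seq I)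
    (F : I -> 'X_{1..l}) :
  'X_[(\sum_(i <- r) F i)%MM] = \prod_(i <- r) 'X_[F i] :> {mpoly R[l]}.
Proof. exact: (big_morph _ (@mpolyXD l R) (@mpolyX0 l R)). Qed.

Section LinSpan.
Variables (k : fieldType).

Lemma lin_span_in (A : lmodType k) (S : A -> Prop) f : S f -> lin_span S f.
Proof.
by move=> Sf; rewrite -[f]addr0 -[f]scale1r; apply: lin_spanD => //; apply: lin_span0.
Qed.

Lemma lin_spanDD (A : lmodType k) (S : A -> Prop) f g :
  lin_span S f -> lin_span S g -> lin_span S (f + g).
Proof.
move=> Sf Sg; elim: Sf => [|c h h' Sh _ IH]; first by rewrite add0r.
by rewrite -addrA; apply: lin_spanD.
Qed.

Lemma lin_spanZ (A : lmodType k) (S : A -> Prop) c f :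
  lin_span S f -> lin_span S (c *: f).
Proof.
elim=> [|c' h h' Sh _ IH]; first by rewrite scaler0; apply: lin_span0.
by rewrite scalerDr scalerA; apply: lin_spanD.
Qed.

Lemma lin_spanM (A : algType k) (S : A -> Prop) :
  (forall f g, S f -> S g -> S (f * g)) ->
  forall f g, lin_span S f -> lin_span S g -> lin_span S (f * g).
Proof.
move=> SM f g Sf Sg; elim: Sf => [|c h h' Sh _ IH].
  by rewrite mul0r; apply: lin_span0.
rewrite mulrDl -scalerAl; apply: lin_spanDD IH; apply: lin_spanZ.
elim: Sg => [|c' e e' Se _ IH]; first by rewrite mulr0; apply: lin_span0.
by rewrite mulrDr -scalerAr; apply: lin_spanD; first exact: SM.
Qed.

Lemma gen_subalg_span (A : algType k) (S T : A -> Prop) :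
  (forall f, S f -> T f) -> T 1 -> (forall f g, T f -> T g -> T (f * g)) ->
  forall f, gen_subalg S f -> lin_span T f.
Proof.
move=> ST T1 TM f; elim=> {f} [f Sf|c|f g _ Tf _ Tg|f g _ Tf _ Tg].
- exact/lin_span_in/ST.
- exact/lin_spanZ/lin_span_in.
- exact: lin_spanDD.
- exact: lin_spanM.
Qed.

Lemma gen_subalg_prod (A : algType k) (S : A -> Prop) (I : Type) (r : seq I)
    (F : I -> A) : (forall i, gen_subalg S (F i)) -> gen_subalg S (\prod_(i <- r) F i).
Proof.
move=> SF; elim: r => [|i r IH]; last by rewrite big_cons; apply: gen_subalgM.
by rewrite big_nil -[1]scale1r; apply: gen_subalg_cst.
Qed.

(** Products of initial monomials are always initial monomials of products, so
    that the other half of the definition of a sagbi basis is the one to check. *)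
Lemma sagbi_basisP (d : Order.disp_t) (V : finOrderType d)
    (S : {mpoly k[#|{: V}|]} -> Prop) :
  (forall f, gen_subalg S f -> f != 0 -> gen_subalg (init_set S) (init_mon f)) ->
  sagbi_basis S.
Proof.
move=> SI g; split.
  elim=> {g} [|c f g [h [Rh nz_h ->]] _ IH].
    by rewrite -[0](scale0r (1 : {mpoly k[#|{: V}|]})); apply: gen_subalg_cst.
  apply: gen_subalgD IH; rewrite -[init_mon h]mul1r scalerAl.
  by apply: gen_subalgM; [apply: gen_subalg_cst | apply: SI].
apply: gen_subalg_span => [f [h [Sh nz_h ->]]||f f'].
- by exists h; split=> //; apply: gen_subalg_in.
- exists 1; rewrite init_mon1 oner_neq0; split=> //.
  by rewrite -[1]scale1r; apply: gen_subalg_cst.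
- move=> [h [Rh nz_h ->]] [h' [Rh' nz_h' ->]]; exists (h * h').
  by rewrite mulf_neq0 // init_monM //; split=> //; apply: gen_subalgM.
Qed.

End LinSpan.

(** * The antidiagonal of a minor *)

Section Cells.

Variables (p m n : nat).

Local Notation N := (p * n.+1)%N.
Local Notation M := (m + p)%N.
Local Notation var := (var p m n).
Implicit Types (v w : var) (i : 'I_N) (j : 'I_M).

(** The variable in row [i] and column [j] of the whole matrix; [vrow] and [vcol]
    recover its position. *)
Definition cell i j : var := (row_level i, row_offset i, j).

Lemma vrow_subproof v : (p * v.1.1 + v.1.2 < N)%N.
Proof.
case: v => [[[l lt_l] [r lt_r]] j] /=; apply: (@leq_trans (p * l + p)%N).
  by rewrite ltn_add2l.
by rewrite -mulnSr leq_mul2l lt_l orbT.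
Qed.

Definition vrow v : 'I_N := Ordinal (vrow_subproof v).

Definition vcol v : 'I_M := v.2.

Lemma vrow_cell i j : vrow (cell i j) = i.
Proof. by apply: val_inj; rewrite /= mulnC -divn_eq. Qed.

Lemma vcol_cell i j : vcol (cell i j) = j. Proof. by []. Qed.

Lemma cellK v : cell (vrow v) (vcol v) = v.
Proof.
case: v => [[l r] j]; have p_gt0 : (0 < p)%N by apply: leq_ltn_trans (ltn_ord r).
congr (_, _, _); apply: val_inj => /=.
  by rewrite mulnC divnMDl // divn_small ?addn0.
by rewrite mulnC modnMDl modn_small.
Qed.

Lemma cell_eq v i j : (cell i j == v) = (i == vrow v) && (j == vcol v).
Proof.
apply/eqP/andP => [<-|[/eqP-> /eqP->]]; last exact: cellK.
by rewrite vrow_cell.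
Qed.

Lemma var_ltE v w :
  (v < w)%O = (vrow v < vrow w)%N || (vrow v == vrow w) && (vcol v < vcol w)%N.
Proof.
rewrite !ltEprodlexi !leEprodlexi !leEord !ltEord -val_eqE /= /vcol.
case: v w => [[[l lt_l] [r lt_r]] [j lt_j]] [[[l' lt_l'] [r' lt_r']] [j' lt_j']] /=.
have [ltl|ltl|<-] := ltngtP l l' => /=.
- have le_l : (p * l + p <= p * l')%N by rewrite -mulnSr leq_mul2l ltl orbT.
  by rewrite (leq_trans _ (leq_trans le_l (leq_addr r' _))) // ltn_add2l.
- have le_l : (p * l' + p <= p * l)%N by rewrite -mulnSr leq_mul2l ltl orbT.
  have: (p * l' + r' < p * l + r)%N.
    by rewrite (leq_trans _ (leq_trans le_l (leq_addr r _))) // ltn_add2l.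
  by case: ltngtP.
- by rewrite ltn_add2l eqn_add2l; case: (ltngtP r r').
Qed.

Lemma mdeg_rows (u : 'X_{1..#|{: var}|}) :
  mdeg u = (\sum_(i < N) wdeg (fun v => vrow v == i) u)%N.
Proof. by rewrite mdeg_mexp (partition_big vrow predT). Qed.

End Cells.

Section Minors.

Variables (k : fieldType) (p m n : nat).

Local Notation N := (p * n.+1)%N.
Local Notation M := (m + p)%N.
Local Notation var := (var p m n).
Local Notation qsymb := (qsymb p m n).
Local Notation qminor := (@qminor k p m n).
Implicit Types (s : qsymb) (t : 'I_p) (v w : var).

Definition qcol s t : 'I_M := tnth (val s.1) t.

Lemma qcol_lt s t t' : (t < t')%N -> (qcol s t < qcol s t')%N.
Proof.
move=> lt_t; have sz_s : size (val s.1) = p := size_tuple _.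
have [j0 _] : exists j : 'I_M, true by exists (qcol s t).
have := @sorted_ltn_nth _ _ ltn_trans 0 _ (valP s.1) t t'.
rewrite !inE !size_map sz_s !ltn_ord => /(_ isT isT lt_t).
by rewrite !(nth_map j0) ?sz_s // /qcol !(tnth_nth j0).
Qed.

(** The monomial of the Leibniz expansion indexed by the permutation [e]. *)
Definition perm_mnm s (e : 'S_p) : 'X_{1..#|{: var}|} :=
  (\sum_(t < p) U_(enum_rank (cell (qrow s.2 t) (qcol s (e t)))))%MM.

Definition antidiag s := perm_mnm s (perm rev_ord_inj).

Lemma qminorE s :
  qminor s = \sum_(e : 'S_p) (-1) ^+ e *: 'X_[perm_mnm s e].
Proof.
apply: eq_bigr => e _; rewrite mulr_sign scaler_sign.
suff -> : \prod_(t < p) mxsub (qrow s.2) (tnth (val s.1)) (Lmx k p m n) t (e t) =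
  'X_[perm_mnm s e] by [].
by rewrite /perm_mnm mpolyX_sum; apply: eq_bigr => t _; rewrite !mxE.
Qed.

Lemma mexp_perm_mnm s e t j :
  mexp (perm_mnm s e) (cell (qrow s.2 t) j) = (qcol s (e t) == j) :> nat.
Proof.
rewrite mexp_sum (bigD1 t) //= mexp1 big1 ?addn0 => [|t' ne].
  by rewrite cell_eq vrow_cell vcol_cell eqxx.
rewrite mexp1 cell_eq vrow_cell -val_eqE /= eqn_add2l.
by rewrite (inj_eq val_inj) (negPf ne).
Qed.

Lemma mexp_perm_mnm_out s e v :
  ~~ (s.2 <= vrow v < s.2 + p)%N -> mexp (perm_mnm s e) v = 0%N.
Proof.
move=> out; rewrite mexp_sum big1 // => t _; rewrite mexp1 cell_eq.
case: eqP => //= et; case/negP: out; rewrite -et /= leq_addr /=.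
by rewrite ltn_add2l.
Qed.

Lemma qrowP s v : (s.2 <= vrow v < s.2 + p)%N ->
  exists2 t : 'I_p, vrow v = qrow s.2 t & (t : nat) = (vrow v - s.2)%N.
Proof.
case/andP=> le_s lt_s; have lt_t : (vrow v - s.2 < p)%N by lia.
by exists (Ordinal lt_t) => //; apply: val_inj; rewrite /= subnKC.
Qed.

Lemma mexp_antidiag s v : mexp (antidiag s) v =
  [exists t : 'I_p, (vrow v == qrow s.2 t) && (qcol s (rev_ord t) == vcol v)] :> nat.
Proof.
have [/qrowP[t et _]|out] := boolP (s.2 <= vrow v < s.2 + p)%N.
  rewrite -{1}(cellK v) et mexp_perm_mnm permE; congr (nat_of_bool _).
  apply/idP/existsP => [ej|[t' /andP[]]]; first by exists t; rewrite eqxx ej.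
  by rewrite -val_eqE /= eqn_add2l (inj_eq val_inj) => /eqP<-.
rewrite mexp_perm_mnm_out //; case: existsP => // -[t /andP[/eqP et _]].
by case/negP: out; rewrite et /= leq_addr ltn_add2l /=.
Qed.

(** In the first row where a permutation differs from the reversal the larger
    columns are already used up, so it picks a smaller column, hence the smallest
    variable in which its monomial and the antidiagonal differ. *)
Lemma antidiag_max s e : e != perm rev_ord_inj -> drl_lt (perm_mnm s e) (antidiag s).
Proof.
move=> ne_e; have [t0 ne_t0] : exists t, e t != rev_ord t.
  apply/existsP; rewrite -negb_forall; apply: contra ne_e => /forallP e_rev.
  by apply/eqP/permP => t; rewrite permE; apply/eqP.
have [t ne_t min_t] := @arg_minP _ _ _ t0 (fun t => e t != rev_ord t) id ne_t0.
have e_lt t' : (t' < t)%N -> e t' = rev_ord t'.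
  by move=> lt_t; apply/eqP; apply: contraTT lt_t => /min_t; rewrite leEord -leqNgt.
have lt_e : (e t < rev_ord t)%N.
  rewrite ltn_neqAle ne_t leqNgt; apply/negP => gt_e.
  have lt_t : (rev_ord (e t) < t)%N.
    by move: gt_e (ltn_ord t) (ltn_ord (e t)) => /=; lia.
  have := e_lt _ lt_t; rewrite rev_ordK => /perm_inj e_t.
  by rewrite e_t ltnn in lt_t.
rewrite /drl_lt /antidiag.
have mdeg_p e' : mdeg (perm_mnm s e') = p.
  rewrite mdeg_sum (eq_bigr _ (fun t _ => mdeg1 _)) sum_nat_const card_ord muln1 //.
rewrite !mdeg_p ltnn eqxx /=; apply/existsP.
exists (cell (qrow s.2 t) (qcol s (e t))).
rewrite !mexp_perm_mnm permE eqxx; apply/andP; split; last first.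
  rewrite (_ : (qcol s (rev_ord t) == qcol s (e t)) = false) //.
  by apply: contraTF (qcol_lt s lt_e) => /eqP->; rewrite ltnn.
apply/forallP => w; apply/implyP; rewrite var_ltE vrow_cell vcol_cell => lt_w.
have [/qrowP[t' et' _]|out] := boolP (s.2 <= vrow w < s.2 + p)%N; last first.
  by rewrite !mexp_perm_mnm_out.
rewrite -(cellK w) et' !mexp_perm_mnm permE; move: lt_w; rewrite et' -val_eqE /=.
rewrite ltn_add2l eqn_add2l => /orP[/e_lt->//|/andP[/eqP/val_inj->] lt_j].
have lt_j' := ltn_trans lt_j (qcol_lt s lt_e).
by rewrite -!val_eqE /= (gtn_eqF lt_j) (gtn_eqF lt_j').
Qed.

Lemma msupp_qminor s u : u \in msupp (qminor s) -> exists e, u = perm_mnm s e.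
Proof.
rewrite qminorE => /msupp_sum_le /flattenP[_ /mapP[e _ ->]].
by move=> /msuppZ_le; rewrite msuppX inE => /eqP->; exists e.
Qed.

Lemma init_qminor s : qminor s != 0 /\ init_mnm (qminor s) = antidiag s.
Proof.
have in_supp : antidiag s \in msupp (qminor s).
  rewrite mcoeff_msupp qminorE raddf_sum (bigD1 (perm rev_ord_inj)) //=.
  rewrite big1 => [|e /(antidiag_max s) lt_e].
    by rewrite mcoeffZ mcoeffX eqxx mulr1 addr0 signr_eq0.
  rewrite mcoeffZ mcoeffX; case: eqP => [e_anti|]; last by rewrite mulr0.
  by rewrite e_anti drl_lt_irr in lt_e.
split; first by apply: contraTneq in_supp => ->; rewrite msupp0.
apply: init_mnm_unique => // _ /msupp_qminor[e ->] ne.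
by apply: antidiag_max; apply: contraNneq ne => ->.
Qed.

Lemma rdeg_qminor s u (i : 'I_N) : u \in msupp (qminor s) ->
  wdeg (fun v => vrow v == i) u = (s.2 <= i < s.2 + p)%N :> nat.
Proof.
case/msupp_qminor => e ->; rewrite wdeg_sum (eq_bigr _ (fun t _ => wdeg1 _ _)).
have [in_i|out] := boolP (s.2 <= i < s.2 + p)%N; last first.
  apply: big1 => t _; rewrite vrow_cell; case: eqP => // et.
  by case/negP: out; rewrite -et /= leq_addr ltn_add2l /=.
have lt_t : (i - s.2 < p)%N by lia.
rewrite (bigD1 (Ordinal lt_t)) //= vrow_cell -val_eqE /= subnKC ?eqxx; last by lia.
rewrite big1 // => t; rewrite -val_eqE vrow_cell -[qrow _ _ == _]val_eqE /=; lia.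
Qed.

End Minors.

(** * Making two adjacent rows equal *)

Section PolyOrder.

Variables (k : fieldType) (d : Order.disp_t) (V : finOrderType d) (P : pred V).
Implicit Types f g : {mpoly k[#|{: V}|]}.

(** The membership of [f] in the [q]-th power of the ideal generated by the
    variables in [P]. *)
Definition order_ge q f : Prop := forall u, u \in msupp f -> (q <= wdeg P u)%N.

Lemma order_ge0 f : order_ge 0 f. Proof. by []. Qed.

Lemma order_geX v : P v -> order_ge 1 'X_(enum_rank v).
Proof. by move=> Pv u; rewrite msuppX inE => /eqP->; rewrite wdeg1 Pv. Qed.

Lemma order_geD q f g : order_ge q f -> order_ge q g -> order_ge q (f + g).
Proof. by move=> qf qg u /msuppD_le; rewrite mem_cat => /orP[/qf|/qg]. Qed.

Lemma order_geZ q c f : order_ge q f -> order_ge q (c *: f).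
Proof. by move=> qf u /msuppZ_le/qf. Qed.

Lemma order_ge_sum q (I : Type) (r : seq I) (F : I -> {mpoly k[#|{: V}|]}) :
  (forall i, order_ge q (F i)) -> order_ge q (\sum_(i <- r) F i).
Proof.
move=> qF; elim/big_ind: _ => [u|f g|i _]; first by rewrite msupp0.
  exact: order_geD.
exact: qF.
Qed.

Lemma order_geM q1 q2 f g :
  order_ge q1 f -> order_ge q2 g -> order_ge (q1 + q2) (f * g).
Proof.
move=> qf qg _ /msuppM_le /allpairsP[[u1 u2] /= [/qf u1f /qg u2g ->]].
by rewrite wdegD leq_add.
Qed.

End PolyOrder.

Section EqualiseRows.

Variables (k : fieldType) (p m n : nat).

Local Notation N := (p * n.+1)%N.
Local Notation M := (m + p)%N.
Local Notation var := (var p m n).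
Local Notation qsymb := (qsymb p m n).
Local Notation qminor := (@qminor k p m n).
Local Notation poly := {mpoly k[#|{: var}|]}.

Variables (i0 i1 : 'I_N) (th : 'I_M).
Hypothesis i01 : i1 = i0.+1 :> nat.

Implicit Types (v : var) (u w : 'X_{1..#|{: var}|}).

(** By Koenig's theorem, the largest number of pairs that can be formed from a
    variable in row [i0] and one strictly left of it in row [i1] is the least
    degree, over all columns [th], of the monomial on [stair]. *)
Definition stair v :=
  (vrow v == i1) && (vcol v < th)%N || (vrow v == i0) && (th < vcol v)%N.

Definition twin v := cell (if vrow v == i0 then i1 else i0) (vcol v).

Definition pivot v := (vcol v == th) && ((vrow v == i0) || (vrow v == i1)).

(** The images are chosen such that rows [i0] and [i1] become equal modulo the
    variables in [stair]; column [th], from which no variable lies in [stair], is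
    normalised to 1, which loses nothing for polynomials homogeneous in each row. *)
Definition eqz_var v : poly :=
  if stair v then 'X_(enum_rank v) + 'X_(enum_rank (twin v))
  else if pivot v then 1 else 'X_(enum_rank v).

Definition equalise (f : poly) : poly :=
  f \mPo [tuple eqz_var (enum_val c) | c < #|{: var}|].

HB.instance Definition _ := GRing.RMorphism.copy equalise
  (comp_mpoly [tuple eqz_var (enum_val c) | c < #|{: var}|]).
HB.instance Definition _ := GRing.Linear.copy equalise
  (comp_mpoly [tuple eqz_var (enum_val c) | c < #|{: var}|]).

Let i10 : (i1 == i0) = false.
Proof. by rewrite -val_eqE /= i01; lia. Qed.

Let i01' : (i0 == i1) = false. Proof. by rewrite eq_sym i10. Qed.

Lemma equaliseX v : equalise 'X_(enum_rank v) = eqz_var v.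
Proof. by rewrite /equalise comp_mpolyXU -tnth_nth tnth_mktuple enum_rankK. Qed.

Lemma stair_row v : stair v -> (vrow v == i0) || (vrow v == i1).
Proof. by case/orP=> /andP[-> _]; rewrite ?orbT. Qed.

Lemma stair_pivot v : stair v -> pivot v = false.
Proof.
rewrite /stair /pivot -[vcol v == th]val_eqE.
by case: ltngtP => //=; rewrite !andbF.
Qed.

Lemma vcol_twin v : vcol (twin v) = vcol v. Proof. by []. Qed.

Lemma vrow_twin v : vrow (twin v) = if vrow v == i0 then i1 else i0.
Proof. exact: vrow_cell. Qed.

Lemma twinK v : (vrow v == i0) || (vrow v == i1) -> twin (twin v) = v.
Proof.
move=> rv; rewrite -[RHS]cellK {1}/twin vrow_twin vcol_twin.
by congr (cell _ _); case/orP: rv => /eqP->; rewrite ?i10 eqxx ?i10.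
Qed.

Lemma twin_row v : (vrow (twin v) == i0) || (vrow (twin v) == i1).
Proof. by rewrite vrow_twin; case: ifP; rewrite eqxx ?orbT. Qed.

Lemma stair_twin v : stair v -> stair (twin v) = false.
Proof.
rewrite /stair vrow_twin vcol_twin; case: ifP => [/eqP->|ne].
  by rewrite i01' i10 !eqxx /= orbF; case: ltngtP.
by rewrite i01' eqxx /= orbF; case: ltngtP; rewrite ?andbF.
Qed.

Lemma twin_inj v v' : stair v -> stair v' -> (twin v == twin v') = (v == v').
Proof.
move=> Sv Sv'; apply/eqP/eqP => [e|->//].
by rewrite -(twinK (stair_row Sv)) e twinK // stair_row.
Qed.

Lemma stair_neq v v' : stair v -> stair v' -> (twin v == v') = false.
Proof. by move=> Sv Sv'; apply: contraTF Sv' => /eqP<-; rewrite stair_twin. Qed.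

(** What remains of [w] in a monomial [u] of its image: factors can only leave
    [stair], towards the other row and in the same column.  Column [th] is not
    constrained. *)
Definition moved w u := forall v,
  [/\ stair v -> (mexp u v <= mexp w v)%N,
      stair v -> (mexp u v + mexp u (twin v) = mexp w v + mexp w (twin v))%N
    & ~~ ((vrow v == i0) || (vrow v == i1)) -> mexp u v = mexp w v].

Lemma moved_refl w : moved w w. Proof. by move=> v; split. Qed.

Lemma movedD w w' u u' : moved w u -> moved w' u' -> moved (w + w')%MM (u + u')%MM.
Proof.
move=> mv mv' v; have [le1 e1 e0] := mv v; have [le1' e1' e0'] := mv' v.
split=> [Sv|Sv|nv]; rewrite !mexpD; first by apply: leq_add; auto.
  by rewrite addnACA e1 // e1' // addnACA.
by rewrite e0 // e0'.
Qed.

Lemma moved_var v u : u \in msupp (eqz_var v) -> moved U_(enum_rank v)%MM u.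
Proof.
rewrite /eqz_var; case: ifP => [Sv|nSv].
  move/msuppD_le; rewrite mem_cat !msuppX !inE => /orP[/eqP->|/eqP->].
    exact: moved_refl.
  move=> v'; rewrite !mexp1; split=> [Sv'|Sv'|nv'].
  - by rewrite stair_neq.
  - by rewrite stair_neq // twin_inj // [v == twin v']eq_sym stair_neq // addnC.
  - have -> : (v == v') = false.
      by apply: contraNF nv' => /eqP<-; apply: stair_row.
    by apply/eqP; rewrite eqb0; apply: contraNN nv' => /eqP<-; apply: twin_row.
case: ifP => [/andP[/eqP cv rv]|_]; last first.
  by rewrite msuppX inE => /eqP->; apply: moved_refl.
rewrite msupp1 inE => /eqP-> v'; rewrite !mexp1 !mexp0; split=> // [Sv'|nv'].
  have -> : (v == v') = false by apply: contraFF nSv => /eqP->.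
  rewrite (_ : (v == _) = false) //; apply: contraTF Sv' => /eqP ev.
  by rewrite /stair -(vcol_twin v') -ev cv ltnn !andbF.
have -> // : (v == v') = false.
by apply: contraNF nv' => /eqP<-.
Qed.

Lemma equalise_monD w v : equalise 'X_[w + U_(enum_rank v)] = equalise 'X_[w] * eqz_var v.
Proof. by rewrite mpolyXD rmorphM /= equaliseX. Qed.

Lemma equalise_moved w u : u \in msupp (equalise 'X_[w]) -> moved w u.
Proof.
elim/mnm_ind: w u => [u|w v IH u].
  by rewrite mpolyX0 rmorph1 msupp1 inE => /eqP->; apply: moved_refl.
rewrite equalise_monD => /msuppM_le /allpairsP[[u1 u2] /= [u1w u2v ->]].
by apply: movedD; [apply: IH | apply: moved_var].
Qed.

Definition drop_pivot w : 'X_{1..#|{: var}|} :=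
  [multinom (if pivot (enum_val c) then 0%N else w c) | c < #|{: var}|]%MM.

Lemma mexp_drop w v : mexp (drop_pivot w) v = if pivot v then 0%N else mexp w v.
Proof. by rewrite /mexp mnmE enum_rankK. Qed.

Lemma drop_pivotD w w' : drop_pivot (w + w')%MM = (drop_pivot w + drop_pivot w')%MM.
Proof.
by apply: mexp_inj => v; rewrite mexpD !mexp_drop mexpD; case: ifP.
Qed.

Lemma drop_pivot1 v : ~~ pivot v -> drop_pivot U_(enum_rank v)%MM = U_(enum_rank v)%MM.
Proof.
move=> nv; apply: mexp_inj => v'; rewrite mexp_drop; case: ifP => // pv'.
rewrite mexp1; suff -> : (v == v') = false by [].
by apply: contraNF nv => /eqP->.
Qed.

(** Only the choice of the first summand in every factor preserves the degree on
    [stair], so the coefficient is 1, whatever the characteristic. *)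
Lemma equalise_coeff w : (equalise 'X_[w])@_(drop_pivot w) = 1.
Proof.
elim/mnm_ind: w => [|w v IH].
  rewrite mpolyX0 rmorph1 mcoeff1 (_ : _ == _) //; apply/eqP/mexp_inj => v.
  by rewrite mexp_drop mexp0 if_same.
rewrite equalise_monD drop_pivotD /eqz_var; case: ifP => [Sv|nSv].
  rewrite drop_pivot1 ?stair_pivot // mulrDr mcoeffD addmC mcoeffMX IH.
  rewrite (_ : _@__ = 0) ?addr0 //; apply/eqP; rewrite mcoeff_eq0.
  apply/negP => /msuppM_le /allpairsP[[u1 u2] /= [u1w]].
  rewrite msuppX inE => /eqP-> /(congr1 (fun u => mexp u v)).
  rewrite !mexpD !mexp1 mexp_drop stair_pivot // eqxx stair_neq //.
  by have [/(_ Sv)] := equalise_moved u1w v; lia.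
case: ifP => pv; last by rewrite drop_pivot1 ?pv // addmC mcoeffMX.
rewrite mulr1 (_ : drop_pivot U_(_)%MM = 0%MM) ?addm0 //.
apply: mexp_inj => v'; rewrite mexp_drop mexp0 mexp1.
by case: (eqVneq v v') => [<-|_]; rewrite ?pv ?if_same.
Qed.

Local Notation rdeg i w := (wdeg (fun v => vrow v == i) w).

(** Compared with [w], the monomial [w'] has factors moved from row [i0] to row
    [i1] left of [th] and from row [i1] to row [i0] right of [th]; the row degrees
    are restored in column [th].  If some factor leaves row [i0] on the left, the
    first such column holds the smallest variable that changes, and if not, the
    smallest is x(i0,th): in both cases its exponent decreases, so [w'] is the
    larger monomial. *)
Lemma moved_drl w w' : moved w' (drop_pivot w) ->
  (forall i, rdeg i w' = rdeg i w) -> drl_lt w' w -> False.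
Proof.
move=> mv deg_w /orP[|/andP[_ /existsP[v /andP[/forallP eq_v lt_v]]]].
  by rewrite !mdeg_rows (eq_bigr _ (fun i _ => deg_w i)) ltnn.
have {}eq_v v' : (v' < v)%O -> mexp w' v' = mexp w v'.
  by move=> lt_v'; apply/eqP; have := eq_v v'; rewrite lt_v'.
have mv_le v' : stair v' -> (mexp w v' <= mexp w' v')%N.
  by move=> Sv'; have [/(_ Sv')] := mv v'; rewrite mexp_drop stair_pivot.
have mv_tw v' : stair v' ->
    (mexp w v' + mexp w (twin v') = mexp w' v' + mexp w' (twin v'))%N.
  move=> Sv'; have [_ /(_ Sv') <- _] := mv v'; rewrite !mexp_drop stair_pivot //.
  case: ifP => // /andP[ct _]; move: Sv'; rewrite /stair -(vcol_twin v').
  by rewrite (eqP ct) ltnn !andbF.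
(* [w'] cannot exceed [w] somewhere in the row of [v] and nowhere be below it *)
have row_le : (exists2 v', vrow v' == vrow v & (mexp w v' < mexp w' v')%N) ->
    (forall v', vrow v' == vrow v -> mexp w v' <= mexp w' v')%N -> False.
  case=> v' rv' lt_v' le_v; have := deg_w (vrow v); apply/eqP.
  rewrite gtn_eqF // /wdeg (bigD1 v') //= [X in (_ < X)%N](bigD1 v') //=.
  by rewrite -addSn leq_add // leq_sum // => v'' /andP[/le_v].
have [rv0|ne0] := eqVneq (vrow v) i0; last have [rv1|ne1] := eqVneq (vrow v) i1.
- have [c_lt|c_ge] := ltnP (vcol v) th.
    have St : stair (twin v) by rewrite /stair vrow_twin vcol_twin rv0 !eqxx c_lt.
    by have := mv_tw _ St; have := mv_le _ St; rewrite twinK ?rv0 ?eqxx //; lia.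
  apply: row_le; first by exists v.
  move=> v' /eqP rv'; have [/eq_v->//|] := boolP (v' < v)%O.
  rewrite var_ltE rv' eqxx ltnn /= -leqNgt leq_eqVlt.
  case/predU1P=> [/val_inj cv|gt_c].
    by rewrite -(cellK v') rv' -cv cellK ltnW.
  by apply: mv_le; rewrite /stair rv' rv0 eqxx (leq_ltn_trans c_ge gt_c) orbT.
- have row1 v' : vrow v' = i1 -> vcol v' != th -> mexp w v' = mexp w' v'.
    move=> rv' ne; have lt_t : (twin v' < v)%O.
      by rewrite var_ltE vrow_twin rv' rv1 i10 i01 ltnSn.
    have et := eq_v _ lt_t; move: ne; rewrite neq_ltn => /orP[c_lt|c_gt].
      have Sv' : stair v' by rewrite /stair rv' eqxx c_lt.
      by have := mv_tw _ Sv'; lia.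
    have St : stair (twin v').
      by rewrite /stair vrow_twin vcol_twin rv' i10 eqxx c_gt orbT.
    by have := mv_tw _ St; rewrite twinK ?rv' ?eqxx ?orbT //; lia.
  have [cv|ne] := eqVneq (vcol v) th; last by move: lt_v; rewrite row1 ?ltnn.
  apply: row_le; first by exists v.
  move=> v' /eqP rv'; have [cv'|ne] := eqVneq (vcol v') th.
    by rewrite -(cellK v') rv' cv' -cv cellK ltnW.
  by rewrite row1 // rv'.
- have [_ _] := mv v; rewrite mexp_drop /pivot (negPf ne0) (negPf ne1) andbF.
  by move=> /(_ isT) e; rewrite e ltnn in lt_v.
Qed.

Lemma wdeg_stair_drop w : wdeg stair (drop_pivot w) = wdeg stair w.
Proof. by apply: eq_bigr => v Sv; rewrite mexp_drop stair_pivot. Qed.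

(** By [moved_drl] no other monomial of [g] contributes to the coefficient of
    [drop_pivot w] in the image of [g]. *)
Lemma stair_wdeg_ge (g : poly) w q : w \in msupp g ->
  {in msupp g, forall w', w' != w -> drl_lt w' w} ->
  {in msupp g, forall w' i, rdeg i w' = rdeg i w} ->
  order_ge stair q (equalise g) -> (q <= wdeg stair w)%N.
Proof.
move=> w_g max_w deg_w ord_g; rewrite -wdeg_stair_drop; apply: ord_g.
have -> : equalise g = \sum_(w' <- msupp g) g@_w' *: equalise 'X_[w'].
  exact: comp_mpolyEX.
rewrite mcoeff_msupp raddf_sum /= (bigD1_seq w) ?msupp_uniq //=.
rewrite mcoeffZ equalise_coeff mulr1.
rewrite big1_seq ?addr0 -?mcoeff_msupp // => w' /andP[ne w'_g].
rewrite mcoeffZ (_ : (equalise _)@__ = 0) ?mulr0 //; apply/eqP; rewrite mcoeff_eq0.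
apply/negP => /equalise_moved/moved_drl; apply; last exact: max_w.
exact: deg_w.
Qed.

Lemma equalise_diff j :
  order_ge stair 1 (eqz_var (cell i1 j) - eqz_var (cell i0 j)).
Proof.
rewrite /eqz_var /pivot /stair /twin !vrow_cell !vcol_cell !eqxx i10 i01' /=.
rewrite !orbF -val_eqE; case: ltngtP => [lt|gt|eq] /=.
- rewrite addrK; apply: order_geX.
  by rewrite /stair vrow_cell vcol_cell eqxx lt.
- rewrite opprD addrC addrNK -scaleN1r; apply/order_geZ/order_geX.
  by rewrite /stair !vrow_cell vcol_cell eqxx gt orbT.
- by rewrite subrr => u; rewrite msupp0.
Qed.

(** Subtracting the image of row [i0] from that of row [i1] does not change the
    determinant, and leaves a row with entries in the ideal generated by [stair]. *)
Lemma equalise_minor (s : qsymb) : (s.2 <= i0)%N -> (i1 < s.2 + p)%N ->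
  order_ge stair 1 (equalise (qminor s)).
Proof.
move=> le_s lt_s; rewrite /Defs.qminor -det_map_mx.
set A := map_mx _ _.
have [t0 e0 _] : exists2 t : 'I_p,
    vrow (cell i0 th) = qrow s.2 t & t = (i0 - s.2)%N :> nat.
  by rewrite -{2}(vrow_cell i0 th); apply: qrowP; rewrite vrow_cell; lia.
have [t1 e1 _] : exists2 t : 'I_p,
    vrow (cell i1 th) = qrow s.2 t & t = (i1 - s.2)%N :> nat.
  by rewrite -{2}(vrow_cell i1 th); apply: qrowP; rewrite vrow_cell; lia.
rewrite !vrow_cell in e0 e1.
have ne : t1 != t0.
  by apply: contraFneq i10 => e; rewrite e0 e1 e.
have AE t c : A t c = eqz_var (cell (qrow s.2 t) (qcol s c)).
  by rewrite !mxE; apply: equaliseX.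
pose B := \matrix_(t, c) A (if t == t1 then t0 else t) c.
pose C := \matrix_(t, c) (if t == t1 then A t1 c - A t0 c else A t c).
have -> : \det A = 1 * \det B + 1 * \det C.
  apply: (@determinant_multilinear _ _ _ _ _ t1); apply/matrixP=> t c.
  - by rewrite !mxE !eqxx !mul1r addrC subrK.
  - by rewrite [LHS]mxE [LHS]mxE [RHS]mxE eq_sym (negPf (neq_lift _ _)).
  - by rewrite [LHS]mxE [LHS]mxE [RHS]mxE eq_sym (negPf (neq_lift _ _)).
rewrite !mul1r (determinant_alternate ne) => [|c]; last first.
  by rewrite [LHS]mxE [RHS]mxE eqxx (eq_sym t0) (negPf ne).
rewrite add0r (expand_det_row _ t1); apply: order_ge_sum => c.
rewrite -[1%N]addn0; apply: order_geM; last exact: order_ge0.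
by rewrite mxE eqxx !AE -e0 -e1; apply: equalise_diff.
Qed.

End EqualiseRows.

(** * Initial monomials of polynomials in the minors *)

Section MinorProducts.

Variables (k : fieldType) (p m n : nat).

Local Notation N := (p * n.+1)%N.
Local Notation M := (m + p)%N.
Local Notation var := (var p m n).
Local Notation qsymb := (qsymb p m n).
Local Notation qminor := (@qminor k p m n).
Local Notation rdeg i w := (wdeg (fun v => vrow v == i) w).
Implicit Types (ss : seq qsymb) (i : 'I_N) (w : 'X_{1..#|{: var}|}).

Definition wcount ss (lo hi : nat) : nat :=
  count (fun s : qsymb => (lo <= s.2 < hi)%N) ss.

Lemma wcount_cat ss a b c : (a <= b <= c)%N ->
  wcount ss a c = (wcount ss a b + wcount ss b c)%N.
Proof. by move=> abc; elim: ss => //= s ss ->; lia. Qed.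

(** Truncated subtraction is meant: near the top of the matrix the windows that
    meet row [i] are those with 0 <= a <= i. *)
Definition rowcount ss (i : nat) := wcount ss (i.+1 - p) i.+1.

Definition qprod ss : {mpoly k[#|{: var}|]} := \prod_(s <- ss) qminor s.

Lemma rdeg_qprod ss w i : w \in msupp (qprod ss) -> rdeg i w = rowcount ss i.
Proof.
rewrite /qprod; elim: ss w => [|s ss IH] w.
  by rewrite big_nil msupp1 inE => /eqP->; rewrite wdeg0.
rewrite big_cons => /msuppM_le /allpairsP[[u1 u2] /= [u1s u2ss ->]].
rewrite wdegD (rdeg_qminor _ u1s) (IH _ u2ss) /rowcount /=; congr (_ + _)%N.
by lia.
Qed.

Lemma order_qprod ss (i0 i1 : 'I_N) th : i1 = i0.+1 :> nat ->
  order_ge (stair i0 i1 th) (wcount ss (i1.+1 - p) i1) (equalise i0 i1 th (qprod ss)).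
Proof.
move=> i01; rewrite /qprod; elim: ss => [|s ss IH].
  exact: order_ge0.
rewrite big_cons rmorphM /=; apply: order_geM => //.
case: andP => [lt_s|_]; last exact: order_ge0.
by apply: equalise_minor => //; lia.
Qed.

(** The windows below [j + 1] are those that meet row [j] together with those below
    [j + 1 - p], which allows an induction on [j]. *)
Lemma rowcount_inj ss ss' : (0 < p)%N ->
  (forall i, rowcount ss i = rowcount ss' i) ->
  forall j, (j <= N)%N -> wcount ss 0 j = wcount ss' 0 j.
Proof.
move=> p_gt0 eq_r j; elim/ltn_ind: j => -[|j] IH lt_j.
  by rewrite /wcount !(eq_count (a2 := pred0)) ?count_pred0 // => s; rewrite /= andbF.
have lt_p : (j.+1 - p < j.+1)%N by lia.
rewrite !(@wcount_cat _ 0 (j.+1 - p) j.+1) ?leq_subr //.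
rewrite IH //; last by lia.
by congr (_ + _)%N; apply: (eq_r (Ordinal lt_j)).
Qed.

(** A product of minors is homogeneous in each row, so that the homogeneous
    components of a combination of such products are again such combinations. *)
Lemma row_component (f : {mpoly k[#|{: var}|]}) (rho : 'I_N -> nat) :
  lin_span (fun h => exists ss, h = qprod ss) f ->
  exists2 g, lin_span (fun h =>
      exists2 ss, forall i, rowcount ss i = rho i & h = qprod ss) g &
    forall w, (forall i, rdeg i w = rho i) -> g@_w = f@_w.
Proof.
elim=> [|c _ f' [ss ->] _ [g span_g eq_g]]; first by exists 0 => //; apply: lin_span0.
have [/forallP eq_r|ne_r] := boolP [forall i : 'I_N, rowcount ss i == rho i].
  exists (c *: qprod ss + g) => [|w deg_w]; last by rewrite !mcoeffD eq_g.
  by apply: lin_spanD => //; exists ss => // i; apply/eqP.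
exists g => // w deg_w; rewrite mcoeffD eq_g // mcoeffZ.
rewrite (_ : (qprod ss)@_w = 0) ?mulr0 ?add0r //; apply/eqP; rewrite mcoeff_eq0.
apply: contraNN ne_r => w_ss; apply/forallP => i.
by rewrite -deg_w (rdeg_qprod i w_ss).
Qed.

Lemma consecutive_minors_span f : gen_subalg (@consecutive_minors k p m n) f ->
  lin_span (fun h => exists ss, h = qprod ss) f.
Proof.
apply: gen_subalg_span => [_ [s ->]||_ _ [ss ->] [ss' ->]].
- by exists [:: s]; rewrite chi_qvar /qprod big_seq1.
- by exists [::]; rewrite /qprod big_nil.
- by exists (ss ++ ss'); rewrite /qprod big_cat.
Qed.

(** The bound has the same value for all products in the component of [f] that
    contains the initial monomial, by [rowcount_inj]. *)
Lemma init_mnm_bounds f : (0 < p)%N -> 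
  gen_subalg (@consecutive_minors k p m n) f -> f != 0 ->
  exists2 ss, forall i, rdeg i (init_mnm f) = rowcount ss i
    & forall (i0 i1 : 'I_N) th, i1 = i0.+1 :> nat ->
      (wcount ss (i1.+1 - p) i1 <= wdeg (stair i0 i1 th) (init_mnm f))%N.
Proof.
move=> p_gt0 /consecutive_minors_span span_f nz_f.
have [w_f max_w] := init_mnmP nz_f; set w := init_mnm f in w_f max_w *.
have [g span_g eq_g] := row_component (fun i => rdeg i w) span_f.
have w_g : w \in msupp g by rewrite mcoeff_msupp eq_g // -mcoeff_msupp.
have [ss0 eq_ss0] : exists ss, forall i, rowcount ss i = rdeg i w.
  by case: span_g w_g => [|c _ h [ss eq_ss _] _ _]; [rewrite msupp0 | exists ss].
have deg_g : {in msupp g, forall w' i, rdeg i w' = rdeg i w}.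
  move=> w' w'_g i; elim: span_g w'_g => [|c _ h [ss eq_ss ->] _ IH].
    by rewrite msupp0.
  move/msuppD_le; rewrite mem_cat => /orP[/msuppZ_le/(rdeg_qprod i)->|/IH//].
  exact: eq_ss.
exists ss0 => // i0 i1 th i01.
apply: (stair_wdeg_ge i01 w_g _ deg_g) => [w' w'_g|].
  by apply: max_w; rewrite mcoeff_msupp -eq_g -?mcoeff_msupp // => i; apply: deg_g.
elim: span_g => [|c _ h [ss eq_ss ->] _ IH].
  by rewrite rmorph0 => u; rewrite msupp0.
rewrite linearP /=; apply: order_geD IH; apply: order_geZ.
suff -> : wcount ss0 (i1.+1 - p) i1 = wcount ss (i1.+1 - p) i1 by apply: order_qprod.
have eq_w j : (j <= N)%N -> wcount ss0 0 j = wcount ss 0 j.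
  by apply: rowcount_inj => // i; rewrite eq_ss.
have le_i : (i1.+1 - p <= i1)%N by lia.
have := eq_w i1 (ltnW (ltn_ord _)).
rewrite !(@wcount_cat _ 0 (i1.+1 - p) i1) // (eq_w (i1.+1 - p)%N); first exact: addnI.
by apply: leq_trans le_i (ltnW (ltn_ord _)).
Qed.

End MinorProducts.

(** * Decomposing a monomial into antidiagonals *)

(** This single equivalence yields all the bounds on the number of entries of a
    sorted list that lie before or after a given one. *)
Lemma sorted_nth_lt (s : seq nat) j u : sorted leq s -> (u < size s)%N ->
  (nth 0%N s u < j)%N = (u < count (fun x => x < j)%N s)%N.
Proof.
move=> srt lt_u; apply/idP/idP => [|lt_c]; last exact: (nth_count_lt 0%N srt lt_c).
apply: contraTT; rewrite -!leqNgt => le_c.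
by apply: (@nth_count_ge _ _ j 0%N) => //; rewrite le_c.
Qed.

Section Tableau.

Variables (p m n : nat).
Hypothesis p_gt0 : (0 < p)%N.

Local Notation N := (p * n.+1)%N.
Local Notation M := (m + p)%N.
Local Notation var := (var p m n).
Local Notation qsymb := (qsymb p m n).
Local Notation rdeg i w := (wdeg (fun v => vrow v == i) w).

Variables (ss : seq qsymb) (w : 'X_{1..#|{: var}|}).
Hypothesis deg_w : forall i, rdeg i w = rowcount ss i.
Hypothesis stair_w : forall (i0 i1 : 'I_N) th, i1 = i0.+1 :> nat ->
  (wcount ss (i1.+1 - p) i1 <= wdeg (stair i0 i1 th) w)%N.

Let vars : seq var := flatten [seq nseq (mexp w v) v | v <- enum {: var}].

Let count_vars P : count P vars = wdeg P w.
Proof.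
rewrite count_flatten -map_comp sumnE big_map big_enum /= [RHS]big_mkcond /=.
by apply: eq_bigr => v _; rewrite count_nseq; case: (P v); rewrite ?mul1n.
Qed.

Let row (i : nat) : seq nat :=
  sort leq [seq (vcol v : nat) | v <- vars & vrow v == i :> nat].

Let count_row Q i :
  count Q (row i) = wdeg (fun v => (vrow v == i :> nat) && Q (vcol v)) w.
Proof.
rewrite (seq.permP (permEl (perm_sort _ _))) count_map count_filter -count_vars.
by apply: eq_count => v; rewrite /= andbC.
Qed.

Let row_sorted i : sorted leq (row i).
Proof. by apply: sort_sorted; apply: leq_total. Qed.

(** The minors with window [a] have the numbers [u] with
    [below a <= u < below a.+1]. *)
Let below j := wcount ss 0 j.

Let below_mono i j : (i <= j)%N -> (below i <= below j)%N.
Proof. by move=> le_ij; rewrite /below (@wcount_cat _ _ _ ss 0 i j) ?leq_addr. Qed.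

Let wcount_below i j : (i <= j)%N -> wcount ss i j = (below j - below i)%N.
Proof. by move=> le_ij; rewrite /below (@wcount_cat _ _ _ ss 0 i j) // addKn. Qed.

Let size_row (i : 'I_N) : size (row i) = (below i.+1 - below (i.+1 - p))%N.
Proof.
rewrite -count_predT count_row -wcount_below ?leq_subr // -[RHS]/(rowcount ss i) -deg_w.
by apply: eq_bigl => v; rewrite andbT.
Qed.

Let row_lt i x : x \in row i -> (x < M)%N.
Proof. by rewrite mem_sort => /mapP[v _ ->]. Qed.

(** The minors meeting row [i] are those from number [below (i.+1 - p)] on, whence
    the shift. *)
Let entry i u := nth 0%N (row i) (u - below (i.+1 - p)).

Let entry_lt (i : 'I_N) u : (below (i.+1 - p) <= u < below i.+1)%N ->
  (u - below (i.+1 - p) < size (row i))%N.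
Proof. by rewrite size_row; lia. Qed.

Let entry_decr (i0 i1 : 'I_N) u : i1 = i0.+1 :> nat ->
  (below (i1.+1 - p) <= u < below i1)%N -> (entry i1 u < entry i0 u)%N.
Proof.
move=> i01 /andP[ge_u lt_u]; rewrite ltnNge; apply/negP => le_e.
have le_b : (below (i0.+1 - p) <= below (i1.+1 - p))%N by apply: below_mono; lia.
have le_b1 : (below i1 <= below i1.+1)%N by apply: below_mono.
have b0 : (below i0.+1 = below i1) by rewrite i01.
have lt1 : (u - below (i1.+1 - p) < size (row i1))%N by apply: entry_lt; lia.
have lt0 : (u - below (i0.+1 - p) < size (row i0))%N by apply: entry_lt; lia.
have := mem_nth 0%N lt1; rewrite -/(entry i1 u) => /row_lt lt_M.
(* The column of the offending entry in row [i1] serves as threshold: at most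
   [u - below (i1.+1 - p)] entries of row [i1] lie before it, and at most
   [below i1 - u - 1] entries of row [i0] after it. *)
have := stair_w (Ordinal lt_M) i01.
rewrite wcount_below; last by lia.
rewrite -count_vars -(@eq_count _ (predU
    (fun v => (vrow v == i1 :> nat) && (vcol v < entry i1 u)%N)
    (fun v => (vrow v == i0 :> nat) && (entry i1 u < vcol v)%N))) //.
have := count_predUI (fun v : var => (vrow v == i1 :> nat) && (vcol v < entry i1 u)%N)
    (fun v => (vrow v == i0 :> nat) && (entry i1 u < vcol v)%N) vars.
rewrite [X in (_ + X)%N](@eq_count _ _ pred0) ?count_pred0; last first.
  move=> v /=; apply/negP => /andP[/andP[/eqP e1 _] /andP[/eqP e0 _]].
  by move: i01; rewrite -e1 e0 => /eqP; rewrite eqn_leq ltnn andbF.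
rewrite addn0 => ->; rewrite !count_vars.
rewrite -(count_row (fun x => x < entry i1 u)%N) -(count_row (fun x => entry i1 u < x)%N).
have := sorted_nth_lt (entry i1 u) (row_sorted i1) lt1; rewrite ltnn => /esym/negbT.
have := sorted_nth_lt (entry i1 u).+1 (row_sorted i0) lt0; rewrite ltnS le_e => /esym.
have := count_predC (fun x => x < (entry i1 u).+1)%N (row i0).
rewrite [X in (_ + X)%N](@eq_count _ _ (fun x => entry i1 u < x)%N) => [|x]; last first.
  by rewrite /= ltnS ltnNge.
by rewrite size_row; lia.
Qed.

Let windows : seq nat := sort leq [seq nat_of_ord s.2 | s <- ss].

Let size_windows : size windows = size ss.
Proof. by rewrite size_sort size_map. Qed.

Let window u := nth 0%N windows u.

Let window_lt u j : (u < size ss)%N -> (window u < j)%N = (u < below j)%N.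
Proof.
move=> lt_u; rewrite sorted_nth_lt ?size_windows //; last first.
  by apply: sort_sorted; apply: leq_total.
by rewrite (seq.permP (permEl (perm_sort _ _))) count_map.
Qed.

Let window_max u : (u < size ss)%N -> (window u < (n * p).+1)%N.
Proof.
rewrite -size_windows => /(mem_nth 0%N); rewrite mem_sort => /mapP[s _].
by rewrite /window => ->.
Qed.

Let window_row_below u i : (u < size ss)%N ->
  (window u <= i < window u + p)%N = (below (i.+1 - p) <= u < below i.+1)%N.
Proof.
move=> lt_u; rewrite -(window_lt _ lt_u) ltnS andbC; congr (_ && _).
by rewrite [RHS]leqNgt -(window_lt _ lt_u); lia.
Qed.

Let window_rowN u t : (u < size ss)%N -> (t < p)%N -> (window u + t < N)%N.
Proof. by move=> /window_max lt_w lt_t; rewrite mulnS (mulnC p); lia. Qed.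

(** The increasing columns of a symbol list the antidiagonal from its bottom row
    upwards, whence [rev_ord]. *)
Let exists_symbol (u : 'I_(size ss)) : exists s : qsymb,
  s.2 = window u :> nat /\
  forall t : 'I_p, qcol s (rev_ord t) = entry (window u + t) u :> nat.
Proof.
have lt_u := ltn_ord u.
have in_row (t : 'I_p) : (window u <= window u + t < window u + p)%N.
  by rewrite leq_addr ltn_add2l /=.
have lt_e (t : 'I_p) : (entry (window u + rev_ord t) u < M)%N.
  apply: (@row_lt (window u + rev_ord t)); apply: mem_nth.
  apply: (@entry_lt (Ordinal (window_rowN lt_u (ltn_ord (rev_ord t))))).
  by have := in_row (rev_ord t); rewrite window_row_below.
pose al := [tuple Ordinal (lt_e t) | t < p].
have al_sorted : sorted ltn [seq nat_of_ord j | j <- al].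
  apply/(sortedP 0%N) => t; rewrite size_map size_tuple => lt_t.
  have lt_t' := ltnW lt_t.
  have al_nth t' (lt' : (t' < p)%N) :
      nth 0%N [seq nat_of_ord j | j <- al] t' = entry (window u + (p - t'.+1)) u.
    have j0 := Ordinal (lt_e (Ordinal lt')).
    rewrite (nth_map j0) ?size_tuple // -[t']/(nat_of_ord (Ordinal lt')).
    by rewrite -tnth_nth tnth_mktuple.
  rewrite !al_nth //.
  have lt1 : (p - t.+1 < p)%N by lia.
  have lt2 : (p - t.+2 < p)%N by lia.
  apply: (@entry_decr (Ordinal (window_rowN lt_u lt2)) (Ordinal (window_rowN lt_u lt1))).
    by rewrite /=; lia.
  have := window_row_below (window u + (p - t.+1)) lt_u.
  have := window_row_below (window u + (p - t.+2)) lt_u.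
  have -> : ((window u + (p - t.+2)).+1 = window u + (p - t.+1))%N by lia.
  by rewrite /=; lia.
exists (exist _ al al_sorted, Ordinal (window_max lt_u)); split=> // t.
by rewrite /qcol tnth_mktuple -[LHS]/(entry _ _) rev_ordK.
Qed.

Lemma antidiag_decomposition : exists ts : seq qsymb, w = (\sum_(s <- ts) antidiag s)%MM.
Proof.
have [f f_spec] := fin_all_exists exists_symbol.
exists [seq f u | u <- enum 'I_(size ss)]; apply: mexp_inj => v.
rewrite mexp_sum big_map big_enum /=.
set lo := below ((vrow v).+1 - p); set hi := below (vrow v).+1.
have le_lo : (lo <= hi)%N by apply/below_mono/leq_subr.
have le_hi : (hi <= size ss)%N by apply: count_size.
have -> : (\sum_(u < size ss) mexp (antidiag (f u)) v =
    \sum_(0 <= u < size ss)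
      ((lo <= u < hi) && (nth 0 (row (vrow v)) (u - lo) == vcol v)))%N.
  rewrite big_mkord; apply: eq_bigr => u _; have [f2 fcol] := f_spec u.
  rewrite mexp_antidiag -(window_row_below _ (ltn_ord u)) -f2; congr (nat_of_bool _).
  apply/existsP/andP => [[t /andP[/eqP rv /eqP <-]]|[/qrowP[t rv _] e_c]].
    by rewrite fcol rv /= -f2 /lo rv /= leq_addr ltn_add2l ltn_ord -/(entry _ _) f2 eqxx.
  exists t; rewrite rv eqxx -val_eqE /= fcol -f2; move: e_c.
  by rewrite rv /= /lo /entry rv.
rewrite (@big_cat_nat _ _ _ lo) //=; last exact: leq_trans le_hi.
rewrite (@big_cat_nat _ _ _ hi lo (size ss)) //=.
rewrite big_nat_cond big1 => [|u]; last by rewrite andbT; lia.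
rewrite [X in (_ + (_ + X))%N]big_nat_cond [X in (_ + (_ + X))%N]big1 => [|u];
  last by rewrite andbT; lia.
rewrite add0n addn0 -{1}(add0n lo) big_addn -size_row.
transitivity (count_mem (vcol v : nat) (row (vrow v))).
  rewrite count_row /wdeg (bigD1 v) ?eqxx //= big1 ?addn0 // => v'.
  case/andP=> /andP[/eqP er /eqP ec] /eqP[]; rewrite -(cellK v') -(cellK v).
  by congr cell; apply: val_inj.
rewrite -sum1_count [LHS]big_mkcond [LHS](big_nth 0%N) big_nat [RHS]big_nat.
apply: eq_bigr => u /andP[_ lt_u]; rewrite addnK.
have -> : (lo <= u + lo < hi)%N.
  by rewrite leq_addl; move: lt_u; rewrite size_row -/lo -/hi; lia.
by rewrite /=; case: eqP.
Qed.

End Tableau.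

Theorem theorem17 (k : fieldType) (p m n : nat) (hp : (1 <= p)%N) (hm : (1 <= m)%N) :
  @sagbi_basis k _ (var p m n) (@consecutive_minors k p m n).
Proof.
apply: sagbi_basisP => f f_in nz_f.
have [ss deg_f stair_f] := init_mnm_bounds hp f_in nz_f.
have [ts e_f] := antidiag_decomposition hp deg_f stair_f.
rewrite /init_mon e_f mpolyX_sum; apply: gen_subalg_prod => s.
have [nz_s init_s] := init_qminor k s.
apply: gen_subalg_in; exists (qminor k s); rewrite /init_mon init_s; split=> //.
by exists s; rewrite chi_qvar.
Qed.
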